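(* Let $f:[a,b]\to\mathbb{R}$ be monotone and absolutely continuous on $[a,b]$, with $f'(x)\neq 0$ for almost every $x\in[a,b]$. Let $c$ and $d$ be the minimum and maximum values of $f$ on $[a,b]$, respectively, and let $G:[c,d]\to\mathbb{R}$ be a function such that $$t\mapsto \frac{G(t)}{|f'(f^{-1}(t))|}$$ is Lebesgue integrable on $[c,d]$. Then $G\circ f$ is Lebesgue integrable on $[a,b]$ and $$\int_{[a,b]} G(f(x))\, d\lambda(x)=\int_{[c,d]} \frac{G(t)}{|f'(f^{-1}(t))|}\, d\lambda(t).$$
   Context: Here $a<b$ are real numbers and $\lambda$ is Lebesgue measure on $\mathbb{R}$; ''almost every'' refers to $\lambda$. The condition on $f'$ means that, outside a $\lambda$-null set, $f'(x)$ exists and is nonzero. In the formula, $f^{-1}:[c,d]\to[a,b]$ denotes the inverse function of $f:[a,b]\to[c,d]$, and the quotient $G(t)/|f'(f^{-1}(t))|$ is understood as a function defined for almost every $t\in[c,d]$ (namely where $f'(f^{-1}(t))$ exists and is nonzero). *)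

(* Defs.v *)
From HB Require Import structures.
From mathcomp Require Import all_boot all_order all_algebra.
From mathcomp Require Import all_classical all_reals all_analysis.
Set Implicit Arguments.
Unset Strict Implicit.
Unset Printing Implicit Defensive.

Import Order.TTheory GRing.Theory Num.Theory.
Import numFieldNormedType.Exports.
Local Open Scope ring_scope.
Local Open Scope classical_set_scope.

(* Lebesgue measure on the sigma-algebra of all Lebesgue measurable sets.
   The library's lebesgue_measure only lives on the Borel sets, for which the
   composite of a function defined almost everywhere need not be measurable. *)
Notation lambda R := (@completed_lebesgue_measure R).

(* A function on [a, b] is a total function R -> R of which only the values on
   [a, b] matter. *)

Definition monotone_on (R : realType) (a b : R) (f : R -> R) : Prop :=
  {in `[a, b]%R &, {homo f : x y / x <= y}} \/
  {in `[a, b]%R &, {homo f : x y /~ x <= y}}.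

Definition absolutely_continuous_on (R : realType) (a b : R) (f : R -> R)
    : Prop :=
  forall eps : R, 0 < eps -> exists2 delta : R, 0 < delta &
    forall (n : nat) (u v : 'I_n -> R),
      (forall i, a <= u i /\ u i < v i /\ v i <= b) ->
      trivIset [set: 'I_n] (fun i => `]u i, v i[) ->
      \sum_(i < n) (v i - u i) < delta ->
      \sum_(i < n) `|f (v i) - f (u i)| < eps.

(* The two-sided derivative depends on values of f outside [a, b] only at the
   endpoints, hence on a null set. *)
Definition nonzero_derivative_at (R : realType) (f : R -> R) (x : R) : Prop :=
  derivable f x 1 /\ f^`() x != 0.

(* t |-> G(t) / |f'(f^-1(t))|, where f^-1 is the inverse of f : [a, b] ->
   f([a, b]). This function is defined almost everywhere; the value 0 on the
   remaining null set is immaterial since lambda is complete. *)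
Definition inv_quotient (R : realType) (a b : R) (f G : R -> R) (t : R) : R :=
  let x := 'pinv_(fun=> a) `[a, b] f t in
  if `[< nonzero_derivative_at f x >] then G t / `|f^`() x| else 0.

(* Main.v *)
Require Import Defs.
From HB Require Import structures.
From mathcomp Require Import all_boot all_order all_algebra.
From mathcomp Require Import measurable_realfun.
From mathcomp Require Import all_classical all_reals all_analysis.
Set Implicit Arguments.
Unset Strict Implicit.
Unset Printing Implicit Defensive.

Import Order.TTheory GRing.Theory Num.Theory.
Import numFieldNormedType.Exports.
Local Open Scope ring_scope.
Local Open Scope classical_set_scope.

(** The proof rests on the measure [nu A = mu (f (A `&` [a, b]))], where [mu]
is Lebesgue measure on the Borel sets.  Since [f] is continuous and injective
([ac_continuous], [monotone_ae_injective]), [nu] is the pushforward of [mu]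
restricted to [f([a, b]) = [c, d]] under the inverse function, so integrating
[h \o f] against [nu] over [a, b] is integrating [h] against [mu] over [c, d]
([exists_image_measure]).

It remains to see that [nu] has density [|f'|].  Absolute continuity of [f]
says that [nu] is small on finite disjoint unions of intervals of small total
length; as a Borel null set has open neighbourhoods of arbitrarily small
measure, [nu] is dominated by [mu] ([ac_dominates]) and has a Radon-Nikodym
density [g].  Because [f] is monotone, the integral of [g] from [a] to [x] is
[f x - f a] up to a constant sign, so Lebesgue's differentiation theorem gives
[g = |f'|] almost everywhere ([ac_measure_density]).  Together these facts make up the change of
variables formula for Borel functions ([monotone_ac_change_of_variables]).

Apply it to [h t = G t / |f'(f^-1 t)|]: then [h (f x) * |f' x| = G (f x)]
wherever [f'] exists and is nonzero.  The function [h] is only measurable for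
the completed sigma-algebra, so it is first replaced by a Borel function equal
to it off a null set [N] ([borel_modification]).  The replacement is harmless
after composition with [f] because [f^-1 N] is again null: its [nu]-measure is
at most [mu N = 0], and the density [|f'|] of [nu] is almost everywhere
positive ([ae_image_notin_null]). *)

Local Notation mu := (@lebesgue_measure _).
Local Notation borel A := (measurable (A : set (measurableTypeR _))).
Local Notation lebesgueT R := (caratheodory_type (@wlength R idfun)^*%mu).

(** * Lebesgue measurable versus Borel *)

Lemma lebesgue_measurable_borel_mod_null (R : realType)
    (A : set (lebesgueT R)) : measurable A ->
  exists X M : set (measurableTypeR R),
    [/\ measurable X, measurable M, mu M = 0%E & A `\` M = X `\` M].
Proof.
move=> mA.
have : (completed_algebra_gen mu).-sigma.-measurable A.
  by rewrite completed_caratheodory_measurable.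
rewrite g_sigma_completed_algebra_genE => -[X mX [N [M [mM M0 NM]] <-]].
exists X, M; split => //; apply/seteqP; split=> x /= [].
  by move=> [//|/NM].
by move=> Xx Mx; split => //; left.
Qed.

Lemma completed_negligibleP (R : realType) (N : set R) :
  (lambda R).-negligible N <-> mu.-negligible N.
Proof.
split=> [[A [mA A0 NA]]|[A [mA A0 NA]]]; last first.
  by exists A; split => //; exact: sub_caratheodory.
have [X [M [mX mM M0 AXM]]] := lebesgue_measurable_borel_mod_null mA.
have X0 : mu (X `\` M) = 0%E.
  by apply/eqP; rewrite -measure_le0 -A0 -AXM; apply: le_outer_measure => x [].
exists ((X `\` M) `|` M); split.
- by apply: measurableU => //; exact: measurableD.
- by rewrite measureU0//; exact: measurableD.
- by rewrite -AXM => x /NA Ax; have [Mx|Mx] := pselect (M x); [right|left].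
Qed.

(** Each superlevel set of [h] at a rational level is Borel up to a Borel null
set, and countably many levels determine [h]; so [h] becomes Borel once it is
set to zero on the union of these null sets. *)
Lemma borel_modification (R : realType) (h : lebesgueT R -> R) :
  measurable_fun [set: lebesgueT R] h ->
  exists2 h0 : measurableTypeR R -> R, measurable_fun setT h0 &
    mu.-negligible [set x | h x != h0 x].
Proof.
move=> mh.
have /choice[A /choice[M hAM]] (q : rat) :
    exists X M : set (measurableTypeR R),
    [/\ measurable X, measurable M, mu M = 0%E &
        [set x | ratr q < h x] `\` M = X `\` M].
  apply: lebesgue_measurable_borel_mod_null.
  rewrite (_ : [set _ | _] = [set: lebesgueT R] `&` h @^-1` `]ratr q, +oo[).
    exact: mh.
  by apply/seteqP; split=> x /=; rewrite in_itv/= andbT// => -[].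
(* the union of all M q, indexed by the naturals to apply countable additivity *)
pose MM := \bigcup_n oapp M set0 (unpickle n).
have mMM : measurable MM.
  apply: bigcupT_measurable => n; case: (unpickle n) => [q|] //=.
  by have [] := hAM q.
have MMM q : M q `<=` MM.
  have -> : M q = oapp M set0 (unpickle (pickle q)) by rewrite pickleK.
  by move=> x Mx; exists (pickle q).
exists (h \_ (~` MM)); last first.
  apply: (@negligibleS _ _ _ _ MM); last first.
    apply: negligible_bigcup => n; case: (unpickle n) => [q|] /=.
      by have [_ mM M0 _] := hAM q; apply/negligibleP.
    exact: negligible_set0.
  move=> x /=; rewrite patchE; case: ifPn; rewrite ?eqxx//.
  by rewrite notin_setE/= => /contrapT.
have mCMM := measurableC mMM.
apply/(measurable_restrictT _ _).1 => // _.
apply: (measurability _ (RGenOInfty.measurableE R)) => //.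
move=> _ [_ [r ->] <-].
rewrite (_ : _ `&` _ =
    \bigcup_(q in [set q : rat | r <= ratr q]) (A q `\` MM)).
  rewrite bigcup_mkcond; apply: bigcupT_measurable_rat => q.
  by case: ifPn => // _; apply: measurableD => //; have [] := hAM q.
apply/seteqP; split=> [x /= [MMx]|x [q /= rq] [Ax MMx]].
  rewrite in_itv/= andbT => /rat_in_itvoo[q /=].
  rewrite in_itv/= => /andP[rq qh]; exists q; first exact: ltW.
  split=> //; have [_ _ _ E] := hAM q.
  have : ([set x | ratr q < h x] `\` M q) x.
    by split => // Mx; apply: MMx; exact: (MMM q).
  by rewrite E => -[].
split=> //; rewrite in_itv/= andbT; apply: (le_lt_trans rq).
have [_ _ _ E] := hAM q.
have : (A q `\` M q) x by split => // Mx; apply: MMx; exact: (MMM q).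
by rewrite -E => -[].
Qed.

Lemma measurable_id_lebesgue_borel (R : realType) :
  measurable_fun [set: lebesgueT R] (idfun : lebesgueT R -> measurableTypeR R).
Proof. by move=> _ Y mY; rewrite setTI; exact: sub_caratheodory. Qed.

(** The Borel Lebesgue measure is, by definition, the pushforward of the
completed one under the identity, so integrals transfer as for any
pushforward. *)
Lemma integrable_completed_lebesgue (R : realType) (D : set R)
    (h : R -> \bar R) :
  borel D -> measurable_fun [set: measurableTypeR R] h ->
  (lambda R).-integrable D h <-> mu.-integrable D h.
Proof.
move=> mD mh; have mid := @measurable_id_lebesgue_borel R.
have E : (\int[lambda R]_(x in D) `|h x| = \int[mu]_(x in D) `|h x|)%E.
  have := @ge0_integral_pushforward _ _ _ _ _ _ mid (lambda R) D
    (fun x => `|h x|%E) mD.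
  by move=> <-//; apply: measurableT_comp => //; exact: measurable_funTS.
split=> /integrableP[mDh]; [rewrite E|rewrite -E] => hoo;
  apply/integrableP; split=> //.
  exact: measurable_funTS.
apply: measurable_funTS => _ Y mY; rewrite setTI; apply: sub_caratheodory.
by rewrite -[X in _ X]setTI; apply: mh.
Qed.

Lemma integral_completed_lebesgue (R : realType) (D : set R)
    (h : R -> \bar R) :
  borel D -> measurable_fun [set: measurableTypeR R] h ->
  mu.-integrable D h ->
  (\int[lambda R]_(x in D) h x = \int[mu]_(x in D) h x)%E.
Proof.
move=> mD mh /(integrable_completed_lebesgue mD mh) ih.
by rewrite -(integral_pushforward (@measurable_id_lebesgue_borel R) mh ih mD).
Qed.

Lemma ae_eq_integrable_complete d (T : measurableType d) (R : realType)
    (m : {measure set T -> \bar R}) (D : set T) (f g : T -> \bar R) :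
  measure_is_complete m -> measurable D -> ae_eq m D f g ->
  m.-integrable D f ->
  m.-integrable D g /\ (\int[m]_(x in D) f x = \int[m]_(x in D) g x)%E.
Proof.
move=> cm mD fg /integrableP[mf intf].
have mg := ae_measurable_fun cm fg mf; split; last exact: ae_eq_integral.
apply/integrableP; split => //.
suff <- : (\int[m]_(x in D) `|f x| = \int[m]_(x in D) `|g x|)%E by [].
apply: ae_eq_integral; [exact: mD|exact: measurableT_comp|
  exact: measurableT_comp|exact: ae_eq_abse].
Qed.

Lemma lebesgue_measure_set2 (R : realType) (x y : R) :
  borel [set x; y] /\ mu [set x; y] = 0%E.
Proof.
split; first by apply: measurableU; exact: measurable_set1.
apply: countable_lebesgue_measure0.
by apply: finite_set_countable; exact: finite_set2.
Qed.

(** * Absolutely continuous functions and dominated measures *)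

Lemma ac_continuous (R : realType) (a b : R) (f : R -> R) :
  absolutely_continuous_on a b f -> {within `[a, b], continuous f}.
Proof.
move=> ac; apply/subspace_continuousP => x; rewrite /= in_itv/= => /andP[ax xb].
apply/cvgrPdist_lt => e e0; have [d d0 acd] := ac _ e0.
have small u v : a <= u -> v <= b -> u < v -> v - u < d -> `|f v - f u| < e.
  move=> au vb uv uvd.
  have := acd 1%N (fun=> u) (fun=> v); rewrite !big_ord1; apply => //.
  by move=> i j _ _ _; rewrite (ord1 i) (ord1 j).
rewrite near_withinE; near=> y; rewrite /= in_itv/= => /andP[ay yb].
have xyd : `|x - y| < d by near: y; exact: (nbhsx_ballx x d d0).
have [xy|yx|->] := ltgtP x y; last by rewrite subrr normr0.
- rewrite distrC; apply: small => //.
  by rewrite -(gtr0_norm (_ : 0 < y - x)) ?subr_gt0// distrC.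
- by apply: small => //; rewrite -(gtr0_norm (_ : 0 < x - y)) ?subr_gt0.
Unshelve. all: end_near. Qed.

Lemma open_interval_subset_oo (R : realType) (I : set R) (a b : R) :
  open I -> is_interval I -> I !=set0 -> I `<=` `]a, b[ ->
  exists u v, [/\ a <= u, u < v, v <= b & I = `]u, v[].
Proof.
move=> oI iI [x0 Ix0] Iab; move/interior_id : (oI) => oIE.
have [u [v Iuv]] : exists u v, I = `]u, v[.
  exists (inf I), (sup I); rewrite -[LHS]oIE interval_bounded_interior//.
  - by exists a => x /Iab; rewrite /= in_itv/= => /andP[/ltW].
  - by exists b => x /Iab; rewrite /= in_itv/= => /andP[_ /ltW].
have uv : u < v.
  rewrite ltNge; apply/negP => vu; move: Ix0; rewrite Iuv/= in_itv/=.
  by move=> /andP[ux0 /(lt_trans ux0)]; rewrite ltNge vu.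
exists u, v; split => //.
- rewrite leNgt; apply/negP => ua.
  have : I (Num.min a ((u + v) / 2)).
    by rewrite Iuv/= in_itv/= lt_min gt_min ua !midf_lt// orbT.
  by move/Iab; rewrite /= in_itv/= lt_min ltxx.
- rewrite leNgt; apply/negP => bv.
  have : I (Num.max b ((u + v) / 2)).
    by rewrite Iuv/= in_itv/= lt_max gt_max bv !midf_lt// orbT.
  by move/Iab; rewrite /= in_itv/= gt_max ltxx andbF.
Qed.

(** The form in which absolute continuity meets the decomposition of an open
set into disjoint open intervals: that decomposition may contain empty
intervals, whereas absolute continuity speaks of nonempty ones, so the finite
family is first reindexed by its nonempty members. *)
Lemma ac_sum_open_intervals (R : realType) (a b : R) (f : R -> R) (eps : R) :
  absolutely_continuous_on a b f -> 0 < eps -> exists2 delta : R, 0 < delta &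
    forall (I : (set R)^nat) (n : nat),
      (forall i, open (I i) /\ is_interval (I i)) ->
      (forall i, I i `<=` `]a, b[) ->
      trivIset setT I -> (\sum_(i < n) mu (I i) < delta%:E)%E ->
    forall nu : set R -> \bar R, nu set0 = 0%E ->
      (forall u v, a <= u -> u < v -> v <= b ->
         nu `]u, v[ = `|f v - f u|%:E) ->
      (\sum_(i < n) nu (I i) <= eps%:E)%E.
Proof.
move=> ac e0; have [d d0 acd] := ac _ e0; exists d => //.
move=> I n oI Iab tI Id nu nu0 nuE.
pose A := [set i : 'I_n | `[< I i !=set0 >]]%SET.
have /choice[u /choice[v uvP]] (i : nat) : exists u v : R, I i !=set0 ->
    [/\ a <= u, u < v, v <= b & I i = `]u, v[].
  have [I0|I0] := pselect (I i !=set0); last by exists 0, 0.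
  have [u [v uv]] := open_interval_subset_oo (oI i).1 (oI i).2 I0 (Iab i).
  by exists u, v.
have AE (i : 'I_#|A|) : I (enum_val i : 'I_n) !=set0.
  by have := enum_valP i; rewrite inE => /asboolP.
have sumA (F : set R -> \bar R) : F set0 = 0%E ->
    (\sum_(i < n) F (I i) = \sum_(i < #|A|) F (I (enum_val i : 'I_n)))%E.
  move=> F0; rewrite -(big_enum_val (A := mem A) (fun i : 'I_n => F (I i))).
  rewrite [RHS]big_mkcond; apply: eq_bigr => i _; case: ifPn => //.
  by rewrite inE => /asboolP /set0P/negP; rewrite negbK => /eqP ->.
rewrite sumA// (eq_bigr (fun i : 'I_#|A| =>
    `|f (v (enum_val i : 'I_n)) - f (u (enum_val i : 'I_n))|%:E)); last first.
  by move=> i _; have [? ? ? ->] := uvP _ (AE i); exact: nuE.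
rewrite sumEFin lee_fin ltW//; apply: acd.
- by move=> i; have [? ? ? _] := uvP _ (AE i).
- move=> i j _ _ [x [xi xj]]; have [_ _ _ Ii] := uvP _ (AE i).
  have [_ _ _ Ij] := uvP _ (AE j); apply/enum_val_inj/val_inj/tI => //.
  by exists x; split; rewrite ?Ii ?Ij.
- rewrite -lte_fin -sumEFin; apply: le_lt_trans Id; rewrite (sumA mu)//.
  apply: lee_sum => i _; have [_ uv _ ->] := uvP _ (AE i).
  by rewrite lebesgue_measure_itv/= lte_fin uv.
Qed.

(** A null set lies in an open set of measure less than [delta], whose trace on
]a, b[ is a disjoint union of open intervals; absolute continuity bounds the
[nu]-measure of every finite subunion by [eps]. *)
Lemma ac_dominates (R : realType) (a b : R) (f : R -> R)
    (nu : {measure set (measurableTypeR R) -> \bar R}) :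
  absolutely_continuous_on a b f ->
  (forall u v, a <= u -> u < v -> v <= b -> nu `]u, v[ = `|f v - f u|%:E) ->
  nu (~` `]a, b[) = 0%E ->
  nu `<< mu.
Proof.
move=> ac nuE nuC; apply/null_content_dominatesP => E mE E0.
have mab : borel `]a, b[ by exact: measurable_itv.
apply/eqP; rewrite -measure_le0; apply/lee_addgt0Pr => e e0; rewrite add0e.
have [d d0 acd] := ac_sum_open_intervals ac e0.
have [|U [oU EU Ud]] := lebesgue_regularity_outer mE _ d0; first by rewrite E0.
have oV : open (U `&` `]a, b[) by apply: openI => //; exact: interval_open.
pose I := open_disjoint_itv oV.
have mI i : borel (I i).
  by apply: is_interval_measurable; exact: open_disjoint_itv_is_interval.
have tI : trivIset setT I by exact: open_disjoint_itv_trivIset.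
have VI : U `&` `]a, b[ = \bigcup_i I i by exact: open_disjoint_itv_bigcup.
have UE : (mu U < d%:E)%E.
  rewrite -(setDUK EU) measureU//; last by rewrite setDIK.
    by rewrite E0 add0e.
  by apply: measurableD => //; exact: open_measurable.
apply: (@le_trans _ _ (nu (U `&` `]a, b[))).
  have mV := open_measurable oV; have mC := measurableC mab.
  apply: (@le_trans _ _ (nu ((U `&` `]a, b[) `|` ~` `]a, b[))).
    apply: le_measure; rewrite ?inE//; first exact: measurableU.
    move=> x Ex; have [xab|xab] := pselect (`]a, b[%classic x); last by right.
    by left; split => //; exact: EU.
  apply: (le_trans (measureU2 nu mV mC)); rewrite -[leRHS]adde0 leeD2l//.
  by rewrite [X in (X <= _)%E]nuC.
rewrite VI measure_bigcup//; apply: lime_le; first exact: is_cvg_nneseries.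
apply: nearW => n; rewrite (eq_bigl xpredT); last by move=> i; rewrite in_setT.
rewrite big_mkord; apply: acd => //.
- by move=> i; split; [exact: open_disjoint_itv_open|
    exact: open_disjoint_itv_is_interval].
- by move=> i x Ix; suff [] : (U `&` `]a, b[) x by []; rewrite VI; exists i.
- apply: le_lt_trans UE; apply: (@le_trans _ _ (mu (U `&` `]a, b[))).
    rewrite VI measure_bigcup// (eq_eseriesl _ (Q := xpredT)); last first.
      by move=> i; rewrite in_setT.
    by rewrite -(big_mkord xpredT (fun i => mu (I i))); exact: nneseries_lim_ge.
  by apply: le_measure; rewrite ?inE//; exact: open_measurable.
Qed.

(** * The density is the absolute value of the derivative *)

(** Treats both directions of monotonicity at once: [s] is the constant sign of
the increments of [f]. *)
Lemma monotone_on_signed (R : realType) (a b : R) (f : R -> R) :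
  a <= b -> monotone_on a b f ->
  exists2 s : R, `|s| = 1 &
    forall x, x \in `[a, b]%R -> f x = f a + s * `|f x - f a|.
Proof.
move=> ab; have aI : a \in `[a, b]%R by rewrite in_itv/= lexx.
case=> fm; [exists 1|exists (-1)]; rewrite ?normrN ?normr1// => x xI;
  have := xI; rewrite in_itv/= => /andP[ax _].
- by rewrite mul1r ger0_norm ?subrKC// subr_ge0; exact: fm.
- by rewrite mulN1r ler0_norm ?opprK ?subrKC// subr_le0; exact: fm.
Qed.

(** With [F x = |f x - f a|] the integral of the density from [a] to [x], [f]
agrees with [f a + s * F] near each interior point, for a sign [s]; and [F] has the
density as its derivative at almost every point. *)
Lemma ac_measure_density (R : realType) (a b : R) (f : R -> R)
    (nu : {finite_measure set (measurableTypeR R) -> \bar R}) :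
  a < b -> monotone_on a b f -> nu `<< mu ->
  (forall u v, a <= u -> u < v -> v <= b -> nu `]u, v[ = `|f v - f u|%:E) ->
  {ae mu, forall x : R, x \in `[a, b]%R ->
    Radon_Nikodym_SigmaFinite.f nu mu x = `|derive1 f x|%:E}.
Proof.
move=> ab fm numu nuE.
set g := Radon_Nikodym_SigmaFinite.f nu mu.
have g0 x : (0 <= g x)%E by exact: Radon_Nikodym_SigmaFinite.f_ge0.
have gfin x : g x \is a fin_num by exact: Radon_Nikodym_SigmaFinite.f_fin_num.
have ig : mu.-integrable setT g.
  exact: Radon_Nikodym_SigmaFinite.f_integrable.
have gE A : borel A -> nu A = (\int[mu]_(x in A) g x)%E.
  by move=> mA; exact: Radon_Nikodym_SigmaFinite.f_integral.
pose gr x := fine (g x).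
have grE : EFin \o gr = g by apply/funext => x /=; rewrite fineK.
have igr : mu.-integrable setT (EFin \o gr) by rewrite grE.
have [s s1 fs] := monotone_on_signed (ltW ab) fm.
pose F x := (\int[mu]_(t in [set` Interval (BRight a) (BRight x)]) gr t)%R.
have FE x : x \in `]a, b[%R -> F x = `|f x - f a|.
  rewrite in_itv/= => /andP[ax xb]; rewrite /F /Rintegral.
  under eq_integral do rewrite fineK//.
  rewrite -gE; last exact: measurable_itv.
  have -> : `]a, x] = `]a, x[ `|` [set x].
    by rewrite (setUitv1 true)//= bnd_simp.
  rewrite measureU//=; first last.
  - apply/seteqP; split => // t [] /=; rewrite in_itv/= => /[swap] ->.
    by rewrite ltxx andbF.
  - have /null_content_dominatesP nm := numu.
    rewrite nuE ?(ltW xb)// [X in (_ + X)%E]nm ?adde0//.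
    exact: lebesgue_measure_set1.
have dF : {ae mu, forall x, a < x -> derivable F x 1 /\ derive1 F x = gr x}.
  apply: (@FTC1 R gr (BRight a)).
    by move=> y; apply: (integrableS measurableT) => //; exact: measurable_itv.
  by apply: open_integrable_locally => //; exact: openT.
have endpoints : {ae mu, forall x : R, x != a /\ x != b}.
  have [mS S0] := lebesgue_measure_set2 a b.
  exists [set a; b]; split => //.
  by move=> x /= /not_andP[] /negP; rewrite negbK => /eqP; [left|right].
apply: (@filterS2 _ _ (ae_filter_ringOfSetsType mu) _ _ _ _ endpoints dF).
move=> x [xa xb] dFx.
rewrite in_itv/= !le_eqVlt eq_sym (negbTE xa) (negbTE xb)/= => xab.
have [dFx1 dFxE] := dFx (proj1 (andP xab)).
have nearE : {near x, (fun y => f a + s * F y) =1 f}.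
  have : \forall y \near x, `]a, b[%classic y.
    apply: open_nbhs_nbhs; split; first exact: interval_open.
    by rewrite /= in_itv.
  apply: filterS => y yab; rewrite FE// -fs//.
  by move: yab; rewrite /= !in_itv/= => /andP[/ltW -> /ltW ->].
have dsF : is_derive x 1 (cst (f a) + s \*: F) (0 + s *: gr x).
  apply: is_deriveD; apply: is_deriveZ.
  by rewrite -dFxE derive1E; exact: derivableP.
have /(near_eq_is_derive nearE)/@derive_val dfx := dsF.
have -> : derive1 f x = s * gr x by rewrite derive1E dfx add0r.
by rewrite normrM s1 mul1r ger0_norm ?fineK// fine_ge0.
Qed.

Lemma integral_density (R : realType)
    (nu : {finite_measure set (measurableTypeR R) -> \bar R})
    (D : set R) (h : R -> \bar R) :
  nu `<< mu -> borel D -> nu.-integrable D h ->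
  mu.-integrable D (h \* Radon_Nikodym_SigmaFinite.f nu mu)%E /\
  (\int[mu]_(x in D) (h x * Radon_Nikodym_SigmaFinite.f nu mu x) =
   \int[nu]_(x in D) h x)%E.
Proof.
move=> numu mD ih; set g := Radon_Nikodym_SigmaFinite.f nu mu.
have ig : mu.-integrable setT g.
  exact: Radon_Nikodym_SigmaFinite.f_integrable.
have g0 x : (0 <= g x)%E by exact: Radon_Nikodym_SigmaFinite.f_ge0.
have mg : measurable_fun D g by apply: measurable_funTS; exact: measurable_int ig.
have mh : measurable_fun D h by exact: measurable_int ih.
have mhg : measurable_fun D (h \* g)%E by exact: emeasurable_funM.
split.
  apply/integrableP; split=> //.
  under eq_integral => x _ do rewrite abseM (gee0_abs (g0 x)).
  rewrite (Radon_Nikodym_SigmaFinite.change_of_variables numu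
    (f := fun x => `|h x|%E))//.
    by have /integrableP[] := ih.
  exact: measurableT_comp.
rewrite -(Radon_Nikodym_change_of_variables numu mD ih).
apply: ae_eq_integral => //.
  apply: emeasurable_funM => //; apply: measurable_funTS; apply: measurable_int.
  exact: Radon_Nikodym_integrable.
by apply: ae_eqe_mul2l; exact: ae_eq_Radon_Nikodym_SigmaFinite.
Qed.

(** * The image measure of an injective continuous function *)

(** A monotone function taking the same value twice is constant in between, so
its derivative vanishes on an interval. *)
Lemma monotone_ae_injective (R : realType) (a b : R) (f : R -> R) :
  monotone_on a b f ->
  {ae mu, forall x : R, x \in `[a, b]%R -> nonzero_derivative_at f x} ->
  {in `[a, b]%R &, injective f}.
Proof.
move=> fm fd; suff lt_inj x y :
    x \in `[a, b]%R -> y \in `[a, b]%R -> x < y -> f x <> f y.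
  move=> x y xI yI fxy; have [xy|yx|//] := ltgtP x y.
    by have := lt_inj _ _ xI yI xy.
  by have := lt_inj _ _ yI xI yx; rewrite fxy.
move=> xI yI xy fxy.
have sub z : z \in `]x, y[%R -> z \in `[a, b]%R /\ f z = f x.
  move=> zxy; move: (xI) (yI) (zxy); rewrite !in_itv/=.
  move=> /andP[ax _] /andP[_ yb] /andP[/ltW xz /ltW zy].
  have zI : z \in `[a, b]%R.
    by rewrite in_itv/= (le_trans ax xz) (le_trans zy yb).
  split; first by move: zI; rewrite in_itv.
  apply/eqP; rewrite eq_le; case: fm => fm.
    by rewrite [X in _ <= X]fxy !fm.
  by rewrite [X in _ && (X <= _)]fxy !fm.
have : mu.-negligible `]x, y[.
  apply: negligibleS fd => z zxy /= H.
  have /H[_ /eqP] := (sub z zxy).1; apply.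
  have nearE : {near z, cst (f x) =1 f}.
    have : \forall t \near z, `]x, y[%classic t.
      by apply: open_nbhs_nbhs; split => //; exact: interval_open.
    by apply: filterS => t /sub[_ ->].
  rewrite derive1E.
  have := near_eq_is_derive nearE (@is_derive_cst _ _ _ (f x) z 1).
  by move=> /@derive_val.
have mxy : borel `]x, y[ by exact: measurable_itv.
move/negligibleP => /(_ mxy); rewrite /= lebesgue_measure_itv/= lte_fin xy.
by move=> /eqP; rewrite -EFinB eqe subr_eq0 gt_eqF.
Qed.

Lemma image_segment_extrema (R : realType) (a b c d : R) (f : R -> R) :
  a <= b -> {within `[a, b], continuous f} ->
  {in `[a, b]%R &, injective f} ->
  (f @` `[a, b]) c -> lbound (f @` `[a, b]) c ->
  (f @` `[a, b]) d -> ubound (f @` `[a, b]) d ->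
  f @` `[a, b] = `[c, d].
Proof.
move=> ab fc finj; rewrite (continuous_inj_image_segment ab fc finj).
set m := Num.min _ _; set M := Num.max _ _ => cJ cl dJ du.
have mM : m <= M by rewrite /m /M ge_min le_max lexx.
have mJ : m \in `[m, M]%R by rewrite in_itv/= lexx.
have MJ : M \in `[m, M]%R by rewrite in_itv/= lexx andbT.
move: (cJ : c \in `[m, M]%R) (dJ : d \in `[m, M]%R); rewrite !in_itv/=.
move=> /andP[mc _] /andP[_ dM].
have -> : c = m by apply/eqP; rewrite eq_le mc andbT; exact: cl.
by have -> : d = M by apply/eqP; rewrite eq_le dM/=; exact: du.
Qed.

Lemma exists_image_measure (R : realType) (a b : R) (f : R -> R) : a <= b ->
  {within `[a, b], continuous f} -> {in `[a, b]%R &, injective f} ->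
  exists2 nu : {finite_measure set (measurableTypeR R) -> \bar R},
    forall A, borel A -> nu A = mu (f @` (A `&` `[a, b])) &
    forall h : R -> \bar R, measurable_fun [set: measurableTypeR R] h ->
      mu.-integrable (f @` `[a, b]) h ->
      nu.-integrable `[a, b] (h \o f) /\
      (\int[nu]_(x in `[a, b]) h (f x) = \int[mu]_(t in f @` `[a, b]) h t)%E.
Proof.
move=> ab fc finj.
pose g := 'pinv_(fun=> a) `[a, b] f.
have gK : {in `[a, b]%R, cancel f g}.
  by move=> x xI; apply: pinvKV; rewrite ?inE// => u v; rewrite !inE; exact: finj.
pose J := f @` `[a, b].
have JE : J = (f @`[a, b])%classic by exact: continuous_inj_image_segment.
have mJ : borel J by rewrite JE; exact: measurable_itv.
have muJ : (mu J < +oo)%E.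
  by rewrite JE lebesgue_measure_itv/=; case: ifP => _; rewrite ?ltry.
have mg : measurable_fun (J : set (measurableTypeR R))
    (g : R -> measurableTypeR R).
  rewrite JE; apply: subspace_continuous_measurable_fun.
    exact: measurable_itv.
  exact: segment_can_continuous.
(* outside J the value a - 1 avoids [a, b], so that phi^-1 [a, b] is J itself *)
pose phi t : measurableTypeR R := if t \in J then g t else a - 1.
have mphi : measurable_fun [set: measurableTypeR R] phi.
  apply: measurable_fun_if => //.
  - by apply: (measurable_fun_bool true); rewrite setTI preimage_mem_true.
  - by rewrite setTI preimage_mem_true.
have phiE A : A `<=` `[a, b] -> phi @^-1` A = f @` A.
  move=> Aab; apply/seteqP; split=> [t|_ [x Ax <-]] /=.
    rewrite /phi; case: ifPn => [/set_mem[x xab <-]|_ /Aab].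
      by rewrite gK// => Ax; exists x.
    by rewrite /= in_itv/= lerBrDl gerDr ler10.
  by rewrite /phi mem_set ?gK//; [exact: Aab|exists x => //; exact: Aab].
have phiJ : phi @^-1` `[a, b] = J by exact: phiE.
have mab : borel `[a, b] by exact: measurable_itv.
pose nu0 : {measure set (measurableTypeR R) -> \bar R} :=
  measure_function_pushforward__canonical__measure_function_Measure mu mphi.
have nu0ab : (nu0 `[a, b] < +oo)%E by rewrite /nu0/= /pushforward phiJ.
pose nu : {finite_measure set (measurableTypeR R) -> \bar R} :=
  mfrestr mab nu0ab.
exists nu => [A mA|h mh ih].
  by rewrite /nu/= /mfrestr /mrestr /= /pushforward phiE.
have mf : measurable_fun (`[a, b] : set (measurableTypeR R))
    (f : R -> measurableTypeR R).
  exact: subspace_continuous_measurable_fun.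
pose k := (h \o f) \_ `[a, b].
have kE x : x \in `[a, b]%classic -> k x = h (f x).
  by move=> xab; rewrite /k patchE xab.
have mk : measurable_fun [set: measurableTypeR R] k.
  by apply/(measurable_restrictT _ _).1 => //; exact: measurableT_comp.
have kphi t : t \in J -> h t = (k \o phi) t.
  move=> /[dup] tJ /set_mem[x xab fxt]; rewrite /= /phi tJ -fxt gK// kE//.
  exact/mem_set.
have ik : mu.-integrable (phi @^-1` `[a, b]) (k \o phi).
  by rewrite phiJ; exact: eq_integrable ih.
have nunu0 (l : R -> \bar R) :
    (\int[nu]_(x in `[a, b]) l x = \int[nu0]_(x in `[a, b]) l x)%E.
  apply: eq_measure_integral => A mA Aab.
  by rewrite /nu/= /mfrestr /mrestr setIidl.
have inu : nu.-integrable `[a, b] k.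
  have /integrableP[mk' kfin] := integrable_pushforward mphi mk ik mab.
  by apply/integrableP; split=> //; rewrite nunu0.
split; first by apply: eq_integrable inu.
transitivity (\int[nu]_(x in `[a, b]) k x)%E.
  by apply: eq_integral => x xab; rewrite kE.
rewrite nunu0 (integral_pushforward mphi mk ik mab) phiJ.
by apply: eq_integral => t tJ; rewrite kphi.
Qed.

Lemma lebesgue_measure_image_oo (R : realType) (u v : R) (f : R -> R) : u < v ->
  {within `[u, v], continuous f} -> {in `[u, v]%R &, injective f} ->
  mu (f @` `]u, v[) = `|f v - f u|%:E.
Proof.
move=> uv fc finj.
have uI : u \in `[u, v]%R by rewrite in_itv/= lexx ltW.
have vI : v \in `[u, v]%R by rewrite in_itv/= lexx ltW.
have imE : f @` `[u, v] = (f @`[u, v])%classic.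
  by apply: continuous_inj_image_segment => //; exact: ltW.
pose S : set (measurableTypeR R) := [set f u; f v].
have -> : f @` `]u, v[ = (f @`[u, v])%classic `\` S.
  rewrite -imE; apply/seteqP; split=> [_ [x xuv <-]|].
    have xI : x \in `[u, v]%R by exact: subset_itv_oo_cc.
    split; first by exists x.
    move: xuv; rewrite /= in_itv/= => /andP[ux xv].
    by move=> [] /finj; rewrite xI ?uI ?vI => /(_ isT isT) E;
      move: ux xv; rewrite E ltxx.
  move=> _ [[x xuv <-]] /= /not_orP[xu xv].
  exists x => //; move: xuv; rewrite /= !in_itv/= !le_eqVlt.
  move=> /andP[/orP[/eqP ux|->]]; first by case: xu; rewrite ux.
  by move=> /orP[/eqP xv'|->//]; case: xv; rewrite xv'.
have [mS S0] := lebesgue_measure_set2 (f u) (f v).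
have mI : borel (f @`[u, v])%classic by exact: measurable_itv.
have -> : mu ((f @`[u, v])%classic `\` S) = mu (f @`[u, v])%classic.
  rewrite [RHS](measureDI mu mI mS) [X in (_ + X)%E](_ : _ = 0%E) ?adde0//.
  by apply/eqP; rewrite -measure_le0 -S0; exact: measureIr.
rewrite lebesgue_measure_itv/= lte_fin -EFinB.
have [fuv|fuv] := leP (f u) (f v).
  rewrite ger0_norm ?subr_ge0//; case: ifPn => //; rewrite -leNgt => fvu.
  have -> : f v = f u by apply/eqP; rewrite eq_le fvu fuv.
  by rewrite subrr.
by rewrite fuv ltr0_norm ?subr_lt0// opprB.
Qed.

(** * Change of variables *)

(** The density [g] is produced along with its description as [|f'|] almost
everywhere because the formula for [mu (f (A `&` [a, b]))] serves to pull null
sets back along [f]. *)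
Lemma monotone_ac_change_of_variables (R : realType) (a b : R) (f : R -> R) :
  a < b -> monotone_on a b f -> absolutely_continuous_on a b f ->
  {in `[a, b]%R &, injective f} ->
  exists g : R -> \bar R,
  [/\ measurable_fun [set: measurableTypeR R] g, forall x, (0 <= g x)%E,
      {ae mu, forall x : R, x \in `[a, b]%R -> g x = `|derive1 f x|%:E},
      forall A, borel A ->
        mu (f @` (A `&` `[a, b])) = (\int[mu]_(x in A) g x)%E &
      forall h : R -> \bar R, measurable_fun [set: measurableTypeR R] h ->
        mu.-integrable (f @` `[a, b]) h ->
        mu.-integrable `[a, b] ((h \o f) \* g)%E /\
        (\int[mu]_(x in `[a, b]) (h (f x) * g x) =
         \int[mu]_(t in f @` `[a, b]) h t)%E].
Proof.
move=> ab fm fac finj; have fc := ac_continuous fac.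
have [nu nuE nuint] := exists_image_measure (ltW ab) fc finj.
have nuitv u v : a <= u -> u < v -> v <= b -> nu `]u, v[ = `|f v - f u|%:E.
  move=> au uv vb.
  have sub x : x \in `[u, v]%R -> x \in `[a, b]%R.
    rewrite !in_itv/= => /andP[ux xv].
    by rewrite (le_trans au ux) (le_trans xv vb).
  rewrite nuE; last exact: measurable_itv.
  rewrite setIidl; last by move=> x /= /subset_itv_oo_cc; exact: sub.
  apply: lebesgue_measure_image_oo => //.
  - by apply: continuous_subspaceW fc => x; exact: sub.
  - by move=> x y xI yI; apply: finj; exact: sub.
have numu : nu `<< mu.
  apply: (ac_dominates fac nuitv).
  have moo : borel `]a, b[ by exact: measurable_itv.
  apply: (etrans (nuE _ (measurableC moo))).
  have -> : ~` `]a, b[ `&` `[a, b] = [set a; b].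
    apply/seteqP; split=> [x /= []|x /= [->|->]]; rewrite !in_itv/=.
    - rewrite !le_eqVlt => /negP; rewrite negb_and => H /andP[].
      move=> /orP[/eqP ->|ax]; first by left.
      by move: H; rewrite ax/= => /negbTE ->; rewrite orbF => /eqP ->; right.
    - by rewrite ltxx lexx ltW.
    - by rewrite ltxx lexx ltW// andbF.
  by rewrite image_setU !image_set1; exact: (lebesgue_measure_set2 _ _).2.
exists (Radon_Nikodym_SigmaFinite.f nu mu); split.
- by have := Radon_Nikodym_SigmaFinite.f_integrable numu; exact: measurable_int.
- exact: (Radon_Nikodym_SigmaFinite.f_ge0 numu).
- exact: ac_measure_density.
- by move=> A mA; rewrite -nuE//; exact: Radon_Nikodym_SigmaFinite.f_integral.
- move=> h mh ih; have [ihf <-] := nuint h mh ih.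
  by apply: (integral_density numu _ ihf); exact: measurable_itv.
Qed.

(** If [N] is null, then [g] has integral zero over the part of [a, b] that [f]
sends into [N], and an almost everywhere positive function can do so only on a
null set. *)
Lemma ae_image_notin_null (R : realType) (a b : R) (f : R -> R)
    (g : R -> \bar R) (N : set R) :
  {within `[a, b], continuous f} ->
  measurable_fun [set: measurableTypeR R] g ->
  (forall x, 0 <= g x)%E ->
  (forall A, borel A ->
     mu (f @` (A `&` `[a, b])) = \int[mu]_(x in A) g x)%E ->
  {ae mu, forall x, x \in `[a, b]%R -> g x != 0%E} ->
  mu.-negligible N ->
  {ae mu, forall x, x \in `[a, b]%R -> ~ N (f x)}.
Proof.
move=> fc mg g0 gE gn0 [M [mM M0 NM]].
have mab : borel `[a, b] by exact: measurable_itv.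
have mf : measurable_fun (`[a, b] : set (measurableTypeR R))
    (f : R -> measurableTypeR R).
  exact: subspace_continuous_measurable_fun.
pose E : set (measurableTypeR R) := `[a, b] `&` f @^-1` M.
have mE : measurable E by exact: mf.
have intE : (\int[mu]_(x in E) `|g x| = 0)%E.
  under eq_integral => x _ do rewrite gee0_abs//.
  rewrite -gE//; apply/eqP; rewrite -measure_le0 -M0.
  by apply: le_outer_measure => _ [x [[_ Mfx] _] <-].
have /(ae_eq_integral_abs mu mE (measurable_funTS mg)) gE0 := intE.
apply: (@filterS2 _ _ (ae_filter_ringOfSetsType mu) _ _ _ _ gE0 gn0).
by move=> x Eg gx xab /NM Mfx; move: (gx xab); rewrite Eg ?eqxx.
Qed.

Theorem theorem4p2 (R : realType) (a b : R) (f : R -> R) (c d : R) (G : R -> R)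
  (hab : a < b)
  (hmono : monotone_on a b f)
  (hac : absolutely_continuous_on a b f)
  (hder : {ae lambda R, forall x : R,
     x \in `[a, b]%R -> nonzero_derivative_at f x})
  (hc : (f @` `[a, b]) c /\ lbound (f @` `[a, b]) c)
  (hd : (f @` `[a, b]) d /\ ubound (f @` `[a, b]) d)
  (hG : (lambda R).-integrable `[c, d] (EFin \o inv_quotient a b f G)) :
  (lambda R).-integrable `[a, b] (EFin \o (G \o f)) /\
  (\int[lambda R]_(x in `[a, b]) (G (f x))%:E =
   \int[lambda R]_(t in `[c, d]) (inv_quotient a b f G t)%:E)%E.
Proof.
have der : {ae mu, forall x : R, x \in `[a, b]%R -> nonzero_derivative_at f x}.
  exact/completed_negligibleP.
have fc := ac_continuous hac.
have finj := monotone_ae_injective hmono der.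
have imE : f @` `[a, b] = `[c, d].
  case: hc hd => cJ cl [dJ du].
  exact: (image_segment_extrema (ltW hab) fc finj cJ cl dJ du).
have [g [mg g0 gder gE gint]] :=
  monotone_ac_change_of_variables hab hmono hac finj.
rewrite imE in gint.
have mab : borel `[a, b] by exact: measurable_itv.
have mcd : borel `[c, d] by exact: measurable_itv.
have mab' : measurable (`[a, b] : set (lebesgueT R)).
  exact: sub_caratheodory.
have mcd' : measurable (`[c, d] : set (lebesgueT R)).
  exact: sub_caratheodory.
have cm := @completed_lebesgue_measure_is_complete R.
have gn0 : {ae mu, forall x, x \in `[a, b]%R -> g x != 0%E}.
  apply: (@filterS2 _ _ (ae_filter_ringOfSetsType mu) _ _ _ _ gder der).
  by move=> x gx dx xab; rewrite gx// eqe normr_eq0; exact: (dx xab).2.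
have [h0 mh0 negh0] :
    exists2 h0 : measurableTypeR R -> R, measurable_fun setT h0 &
    mu.-negligible
      [set t | `[c, d]%classic t /\ inv_quotient a b f G t <> h0 t].
  have mq : measurable_fun [set: lebesgueT R] (inv_quotient a b f G \_ `[c, d]).
    apply/(measurable_restrictT _ _).1; first exact: sub_caratheodory.
    by apply/measurable_EFinP; exact: measurable_int hG.
  have [h0 mh0 h0E] := borel_modification mq.
  exists h0 => //; apply: negligibleS h0E => t [tcd /= /eqP].
  by rewrite patchE mem_set.
have hh0 : ae_eq (lambda R) `[c, d]
    (EFin \o inv_quotient a b f G) (EFin \o h0).
  apply/completed_negligibleP; apply: negligibleS negh0.
  move=> t /= /not_implyP[tcd H].
  by split=> // E; apply: H; rewrite E.
have [ih0 int_h0] := ae_eq_integrable_complete cm mcd' hh0 hG.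
have meh0 : measurable_fun [set: measurableTypeR R] (EFin \o h0).
  exact/measurable_EFinP.
have {}ih0 : mu.-integrable `[c, d] (EFin \o h0).
  exact/integrable_completed_lebesgue.
have int_h0' := integral_completed_lebesgue mcd meh0 ih0.
have [ik int_k] := gint _ meh0 ih0.
pose k := (((EFin \o h0) \o f) \* g)%E \_ `[a, b].
have kE x : x \in `[a, b]%classic -> k x = ((h0 (f x))%:E * g x)%E.
  by move=> xab; rewrite /k patchE xab.
have mk : measurable_fun [set: measurableTypeR R] k.
  by apply/(measurable_restrictT _ _).1 => //; exact: measurable_int ik.
have {}ik : mu.-integrable `[a, b] k.
  by apply: eq_integrable ik => // x xab; rewrite kE.
have int_k' := integral_completed_lebesgue mab mk ik.
have {}ik := (integrable_completed_lebesgue mab mk).2 ik.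
have kG : ae_eq (lambda R) `[a, b] k (EFin \o (G \o f)).
  apply/completed_negligibleP.
  have h0f : {ae mu, forall x, x \in `[a, b]%R ->
      h0 (f x) = inv_quotient a b f G (f x)}.
    have := ae_image_notin_null fc mg g0 gE gn0 negh0.
    apply: (@filterS _ _ (ae_filter_ringOfSetsType mu)) => x Nx xab.
    apply: contrapT => H; apply: (Nx xab); split.
      by rewrite -imE; exists x.
    by move=> E; apply: H.
  have : \forall x \ae mu, `[a, b]%classic x -> k x = (G (f x))%:E.
    apply: (@filterS3 _ _ (ae_filter_ringOfSetsType mu) _ _ _ _ _ gder der h0f).
    move=> x gx dx h0x xab; rewrite kE ?inE// gx// h0x// /inv_quotient.
    rewrite pinvKV ?inE//; last by move=> u v; rewrite !inE; exact: finj.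
    rewrite asboolT; last exact: dx.
    by rewrite -EFinM divfK// normr_eq0; exact: (dx xab).2.
  by [].
have [iGf intGf] := ae_eq_integrable_complete cm mab' kG ik.
split=> //; rewrite -intGf int_k' [RHS]int_h0 int_h0' -int_k.
by apply: eq_integral => x xab; rewrite kE.
Qed.
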